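(* Let $Y$ be a finite subset of a group $(G,\ast)$, and suppose that $Y$ is not arithmetically-free. Then there exists a non-nilpotent Lie algebra $L$ that is graded by $G$ with support $Y$. This Lie algebra $L$ is metabelian and its dimension is $|Y|$.
   Context: A grading of a Lie algebra $L$ by a group $(G,\ast)$ is a decomposition $L=\bigoplus_{g\in G}L_g$ into subspaces with $[L_g,L_h]\subseteq L_{g\ast h}$ for all $g,h\in G$. Its support is the set $\{g\in G : L_g\neq\{0\}\}$. Metabelian means $[[L,L],[L,L]]=0$. Arithmetically-free: a subset $X$ of an abelian group $(G,+)$ is arithmetically-free iff $X$ is finite and for all $x,g\in X$ the set $\mathcal{O}(x,g)=\{x,x+g,x+2g,x+3g,\dots\}$ is not contained in $X$. More generally, a subset $X$ of an arbitrary group $(G,\ast)$ is arithmetically-free iff $X$ is finite and every subset $Z$ of $X$ consisting of pairwise commuting elements is arithmetically-free (that is, for all $x,g\in Z$ the set $\{x,\,x\ast g,\,x\ast g\ast g,\,\dots\}$ is not contained in $Z$).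
   Formalization: The claim that the dimension of L is |Y| is made only for Y ≠ {1}: the set {1} is not arithmetically-free, but every 1-dimensional Lie algebra is abelian, hence nilpotent; the other claims are kept for Y = {1}. *)

(* Defs.v *)
From HB Require Import structures.
From mathcomp Require Import all_boot all_order all_algebra finmap.
From mathcomp Require Import boolp classical_sets functions cardinality.

Set Implicit Arguments.
Unset Strict Implicit.
Unset Printing Implicit Defensive.

Import GRing.Theory.

Local Open Scope ring_scope.
Local Open Scope classical_set_scope.

Section ArithmeticallyFree.
Variable G : groupType.

Definition orbit_set (x g : G) : set G :=
  [set (x * g ^+ n)%g | n in [set: nat]].

(* The notion for subsets consisting of pairwise commuting elements, where the
   group operation may be thought of as an addition. *)
Definition comm_arith_free (Z : set G) : Prop :=
  finite_set Z /\ forall x g : G, Z x -> Z g -> ~ (orbit_set x g `<=` Z).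

Definition pairwise_commuting (Z : set G) : Prop :=
  forall x y : G, Z x -> Z y -> commute x y.

Definition arith_free (X : set G) : Prop :=
  finite_set X /\
  forall Z : set G, Z `<=` X -> pairwise_commuting Z -> comm_arith_free Z.

End ArithmeticallyFree.

(* [x, x] = 0 rather than antisymmetry, so that characteristic 2 is covered. *)
HB.mixin Record Lmodule_isLieAlgebra (F : fieldType) L of GRing.Lmodule F L := {
  lie : L -> L -> L;
  lie_linearl : forall v : L, linear (lie^~ v);
  lie_linearr : forall u : L, linear (lie u);
  lie_alt : forall u : L, lie u u = 0;
  lie_jacobi : forall u v w : L,
    lie u (lie v w) + lie v (lie w u) + lie w (lie u v) = 0
}.

#[short(type="lieAlgType")]
HB.structure Definition LieAlgebra (F : fieldType) :=
  { L of GRing.Lmodule F L & Lmodule_isLieAlgebra F L }.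

#[short(type="finLieAlgType")]
HB.structure Definition FinLieAlgebra (F : fieldType) :=
  { L of Vector F L & LieAlgebra F L }.

Section FiniteDimensionalLie.
Variables (F : fieldType) (L : finLieAlgType F).
Implicit Types U V W : {vspace L}.

(* [U, V], the span of all brackets of elements of U and V (see lie_prodvP);
   by bilinearity bases suffice, as in falgebra's prodv. *)
Definition lie_prodv U V : {vspace L} :=
  <<allpairs lie (vbasis U) (vbasis V)>>%VS.

Lemma lie_prodvP U V W :
  reflect (forall u v, u \in U -> v \in V -> lie u v \in W)
          (lie_prodv U V <= W)%VS.
Proof.
apply: (iffP idP) => [sUVW u v Uu Vv|sUVW]; last first.
  apply/span_subvP=> _ /allpairsP[[u v] /= [Uu Vv ->]].
  by apply: sUVW; apply: vbasis_mem.
pose fl w := GRing.isLinear.Build F L L _ _ (@lie_linearl F L w).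
pose fr w := GRing.isLinear.Build F L L _ _ (@lie_linearr F L w).
pose lfl w : {linear L -> L} := HB.pack (lie^~ w) (fl w).
pose lfr w : {linear L -> L} := HB.pack (lie w) (fr w).
rewrite (coord_vbasis Uu) -[lie _ v]/(lfl v _) linear_sum rpred_sum //= => i _.
rewrite -[lie _ v]/(lfl v _) linearZ rpredZ //=.
rewrite (coord_vbasis Vv) -[lie _ _]/(lfr _ _) linear_sum rpred_sum //= => j _.
rewrite -[lie _ _]/(lfr _ _) linearZ rpredZ //=.
apply: (subvP sUVW); apply: memv_span; apply: allpairs_f;
  by rewrite mem_nth ?size_tuple.
Qed.

Fixpoint lower_central (n : nat) : {vspace L} :=
  if n is m.+1 then lie_prodv fullv (lower_central m) else fullv.

Definition nilpotent_lie : Prop := exists n : nat, lower_central n = 0%VS.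

Definition metabelian_lie : Prop :=
  lie_prodv (lie_prodv fullv fullv) (lie_prodv fullv fullv) = 0%VS.

(* L is the internal direct sum of the L_g: as G may be infinite, this is
   expressed by directness of all finite subsums, which together exhaust L. *)
Definition lie_grading (G : groupType) (Lg : G -> {vspace L}) : Prop :=
  [/\ forall (g h : G) (u v : L),
        u \in Lg g -> v \in Lg h -> lie u v \in Lg (g * h)%g,
      forall s : {fset G}, directv (\sum_(g : s) Lg (val g))%VS
    & forall v : L, exists s : {fset G}, v \in (\sum_(g : s) Lg (val g))%VS].

Definition grading_support (G : groupType) (Lg : G -> {vspace L}) : set G :=
  [set g | Lg g <> 0%VS].

End FiniteDimensionalLie.

Arguments nilpotent_lie {F} L.
Arguments metabelian_lie {F} L.

(* Main.v *)
(* If l is a linear form and D an operator with l o D = 0, then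
   [u, v] = l(u) D(v) - l(v) D(u) is a metabelian Lie bracket; it is not
   nilpotent as soon as l <> 0 and D fixes a nonzero vector of the kernel of l.
   If Y is not arithmetically free, it contains commuting x, g and the whole
   orbit x, xg, xg^2, ..., so g has finite order. On the space with basis
   (e_y), y in Y, take for l the coordinate of e_g and for D the operator
   e_y -> e_(gy) on the orbit, zero elsewhere. Then D permutes the orbit and
   fixes its indicator vector, while l o D = 0 provided that g is not itself in
   the orbit. *)

Require Import Defs.
From HB Require Import structures.
From mathcomp Require Import all_boot all_order all_algebra finmap.
From mathcomp Require Import boolp classical_sets functions cardinality.

Set Implicit Arguments.
Unset Strict Implicit.
Unset Printing Implicit Defensive.

Import GRing.Theory.

Local Open Scope ring_scope.
Local Open Scope classical_set_scope.

(** * The Lie algebra of a linear form and an operator *)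

Section FormOperatorLie.
Variables (F : fieldType) (V : vectType F).
Variables (l : {scalar V}) (D : {linear V -> V}).
Hypothesis lD0 : forall v, l (D v) = 0.

Definition form_bracket (u v : V) : V := l u *: D v - l v *: D u.

Lemma form_bracket_linearl v : linear (form_bracket^~ v).
Proof.
move=> a u1 u2; rewrite /form_bracket (linearP l) (linearP D) /=.
rewrite scalerDl scalerBr scalerDr.
by rewrite !scalerA opprD addrACA (mulrC (l v)).
Qed.

Lemma form_bracket_alt v : form_bracket v v = 0.
Proof. exact: subrr. Qed.

Lemma form_bracket_anti u v : form_bracket u v = - form_bracket v u.
Proof. by rewrite /form_bracket opprB. Qed.

Lemma form_bracket_linearr u : linear (form_bracket u).
Proof.
move=> a v1 v2; rewrite form_bracket_anti form_bracket_linearl opprD -scalerN.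
by rewrite -!form_bracket_anti.
Qed.

Lemma form_bracket_in_ker u v : l (form_bracket u v) = 0.
Proof. by rewrite linearB !linearZ /= !lD0 !mulr0 subrr. Qed.

(** Inner brackets lie in the kernel of [l], so [[u, [v, w]]] is [l u *: D [v, w]]. Expanding, each
    product such as [l u * l v] multiplies [D (D w)] twice, with opposite signs. *)
Lemma form_bracket_jacobi u v w :
  form_bracket u (form_bracket v w) + form_bracket v (form_bracket w u) +
  form_bracket w (form_bracket u v) = 0.
Proof.
rewrite {1 3 5}/form_bracket !form_bracket_in_ker !scale0r !subr0.
have DZ a x : D (a *: x) = a *: D x by rewrite linearZ.
rewrite /form_bracket !raddfB /= !DZ !scalerA.
rewrite (mulrC (l v) (l u)) (mulrC (l w) (l u)) (mulrC (l w) (l v)).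
by rewrite addrAC !subrKA subrr.
Qed.

(** An alias of [V] whose type carries the proof of [l o D = 0], on which the Jacobi identity
    depends. *)
Definition form_lie of (forall v, l (D v) = 0) : Type := V.

Local Notation L := (form_lie lD0).

HB.instance Definition _ := Vector.on L.
HB.instance Definition _ := Lmodule_isLieAlgebra.Build F L
  form_bracket_linearl form_bracket_linearr form_bracket_alt
  form_bracket_jacobi.

Lemma form_lie_metabelian : metabelian_lie L.
Proof.
pose W := lie_prodv (fullv : {vspace L}) fullv.
(* [l] is repackaged with values in the vector space [F^o], so that its kernel becomes a subspace of
   [L]. *)
have lf_lin : linear (l : L -> F^o) by move=> a u v; rewrite [LHS]linearP.
pose fl := GRing.isLinear.Build F L F^o _ _ lf_lin.
pose lf : {linear L -> F^o} := HB.pack (l : L -> F^o) fl.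
pose K : {vspace L} := lker (linfun lf).
have KP (u : L) : (u \in K) = (l u == 0) by rewrite memv_ker lfunE.
have /subvP WK : (W <= K)%VS.
  by apply/lie_prodvP => u v _ _; rewrite KP form_bracket_in_ker.
apply/eqP; rewrite -subv0; apply/lie_prodvP => u v /WK + /WK.
rewrite !KP /lie /= /form_bracket => /eqP-> /eqP->.
by rewrite !scale0r subrr mem0v.
Qed.

(** Since [[u, w] = w], the vector [w] survives in every term of the lower central series. *)
Lemma form_lie_not_nilpotent (u w : V) :
  l u = 1 -> l w = 0 -> D w = w -> w != 0 -> ~ nilpotent_lie L.
Proof.
move=> lu1 lw0 Dww w_neq0 [n Ln0].
suff: (w : L) \in lower_central L n by rewrite Ln0 memv0; apply/negP.
elim: n {Ln0} => [|n IHn] /=; first exact: memvf.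
have -> : w = lie (u : L) (w : L).
  by rewrite /lie /= /form_bracket lu1 lw0 scale1r scale0r subr0.
by move/lie_prodvP: (subvv (lie_prodv fullv (lower_central L n))); apply;
   rewrite ?memvf.
Qed.

End FormOperatorLie.

(** * A graded model on the functions over a finite index set *)

Section GradedShift.
Variables (F : fieldType) (G : groupType) (T : finType) (deg : T -> G).
Variables (t0 : T) (S : pred T) (tau : T -> T).
Hypothesis t0NS : ~~ S t0.

Local Notation V := {ffun T -> F^o}.

Definition coord_form (v : V) : F := v t0.

Lemma coord_form_linear : scalar coord_form.
Proof. by move=> a u v; rewrite /coord_form !ffunE. Qed.

HB.instance Definition _ :=
  GRing.isLinear.Build F V F _ coord_form coord_form_linear.

(** Pulling coordinates back along [tau] pushes basis vectors forward: for the orbit, [tau] is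
    division by [g] and the operator multiplies by [g]. *)
Definition shift_op (v : V) : V := [ffun s => if S s then v (tau s) else 0].

Lemma shift_op_linear : linear shift_op.
Proof.
move=> a u v; apply/ffunP => s; rewrite !ffunE.
by case: ifP => _; rewrite ?ffunE // scaler0 addr0.
Qed.

HB.instance Definition _ :=
  GRing.isLinear.Build F V V _ shift_op shift_op_linear.

Lemma coord_shift_op v : coord_form (shift_op v) = 0.
Proof. by rewrite /coord_form ffunE (negbTE t0NS). Qed.

Definition shift_lie : finLieAlgType F := form_lie coord_shift_op.

Lemma shift_lie_dim : \dim {:shift_lie} = #|T|.
Proof. by rewrite dimvf /dim /= muln1. Qed.

Lemma shift_lie_metabelian : metabelian_lie shift_lie.
Proof. exact: form_lie_metabelian. Qed.

Hypothesis tauS : forall s, S s -> S (tau s).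

(* The indicator of S is fixed by the shift, hence lies in every term of the
   lower central series. *)
Lemma shift_lie_not_nilpotent s0 : S s0 -> ~ nilpotent_lie shift_lie.
Proof.
move=> Ss0.
pose u : V := [ffun t => (t == t0)%:R]; pose w : V := [ffun t => (S t)%:R].
apply: (@form_lie_not_nilpotent _ _ _ _ coord_shift_op u w).
- by rewrite /= /coord_form ffunE eqxx.
- by rewrite /= /coord_form ffunE (negbTE t0NS).
- apply/ffunP => s; rewrite !ffunE.
  by case: ifP => // Ss; rewrite tauS.
- apply/eqP => /ffunP/(_ s0); rewrite !ffunE Ss0 => /eqP.
  by rewrite oner_eq0.
Qed.

Definition off_degree (g : G) (v : V) : V :=
  [ffun t => if deg t == g then 0 else v t].

Lemma off_degree_linear g : linear (off_degree g).
Proof.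
move=> a u v; apply/ffunP => t; rewrite !ffunE.
by case: ifP => _; rewrite ?ffunE // scaler0 addr0.
Qed.

HB.instance Definition _ g :=
  GRing.isLinear.Build F V V _ (off_degree g) (off_degree_linear g).

Definition degree_space (g : G) : {vspace shift_lie} :=
  lker (linfun (off_degree g)).

Lemma degree_spaceP g (v : V) :
  reflect (forall t, deg t != g -> v t = 0)
          ((v : shift_lie) \in degree_space g).
Proof.
rewrite memv_ker lfunE /=; apply: (iffP eqP) => [/ffunP v0 t tg|v0].
  by have := v0 t; rewrite !ffunE (negbTE tg).
apply/ffunP => t; rewrite !ffunE; case: ifPn => // /v0; exact.
Qed.

Lemma degree_space_support : grading_support degree_space = range deg.
Proof.
apply/seteqP; split => [g|_ [t _ <-]]; rewrite /grading_support /=; last first.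
  move=> dt0; have: ([ffun s => (s == t)%:R] : V) \in degree_space (deg t).
    apply/degree_spaceP => s; rewrite ffunE.
    by have [->|//] := eqVneq s t; rewrite eqxx.
  rewrite dt0 memv0 => /eqP/ffunP/(_ t); rewrite !ffunE eqxx => /eqP.
  by rewrite oner_eq0.
apply: contra_notP => gNdeg; apply/eqP; rewrite -subv0.
apply/subvP => v /degree_spaceP vg; rewrite memv0; apply/eqP/ffunP => t.
rewrite ffunE; apply: vg; apply/eqP => dtg; apply: gNdeg.
by exists t.
Qed.

Hypothesis deg_tau : forall s, S s ->
  deg s = (deg t0 * deg (tau s))%g /\ commute (deg t0) (deg (tau s)).

Lemma degree_space_grading : lie_grading degree_space.
Proof.
split.
- move=> g h u v /degree_spaceP ug /degree_spaceP vh.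
  apply/degree_spaceP => t tgh.
  (* Covers both halves of the bracket: [l] sees only degree [deg t0] and the shift multiplies
     degrees by [deg t0], so a nonzero term has degree [a * b], which by commutation is also
     [b * a]. *)
  have zero (a b : G) (x y : V) : (forall t, deg t != a -> x t = 0) ->
    (forall t, deg t != b -> y t = 0) -> (a * b = g * h \/ b * a = g * h)%g ->
     coord_form x *: shift_op y t = 0.
    move=> xa yb abgh; rewrite ffunE /coord_form.
    case: ifPn => [St|]; last by rewrite scaler0.
    have [dt com] := deg_tau St.
    have [t0a|/xa->] := eqVneq (deg t0) a; last by rewrite scale0r.
    have [tb|/yb->] := eqVneq (deg (tau t)) b; last by rewrite scaler0.
    move: tgh com; rewrite dt t0a tb => /eqP + com.
    by case: abgh => <-; rewrite ?com.
  have -> : (lie u v : V) t =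
      coord_form u *: shift_op v t - coord_form v *: shift_op u t.
    by rewrite [LHS]ffunE [X in X + _]ffunE [X in _ + X]ffunE [X in _ - X]ffunE.
  rewrite (zero g h) //; last by left.
  by rewrite (zero h g) ?subrr //; right.
- move=> s; apply/directv_sum_independent => us us_deg us0 g _.
  apply/ffunP => t; rewrite ffunE.
  have [dtg|dtg] := eqVneq (deg t) (val g); last first.
    by have /degree_spaceP/(_ t dtg) := us_deg g isT.
  (* At coordinate [t] only the summand of degree [deg t] can be nonzero. *)
  have /ffunP/(_ t) := us0; rewrite sum_ffunE ffunE (bigD1 g) //=.
  rewrite big1 ?addr0 // => h hg.
  have /degree_spaceP := us_deg h isT; apply.
  by rewrite dtg eq_sym (inj_eq val_inj).
- move=> v; exists [fset deg t | t in T]%fset.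
  apply/memv_sumP.
  exists (fun g => [ffun t => if deg t == val g then v t else 0]).
    by move=> g _; apply/degree_spaceP => t /negbTE tg; rewrite ffunE tg.
  apply/ffunP => t; rewrite sum_ffunE.
  have dtT : deg t \in [fset deg t | t in T]%fset by apply/imfsetP; exists t.
  rewrite (bigD1 [` dtT]%fset) //= ffunE eqxx big1 ?addr0 // => g gt.
  rewrite ffunE; case: eqP => // dtg; case/eqP: gt.
  by apply: val_inj; rewrite /= -dtg.
Qed.

(** [deg] may repeat values, so the dimension counts indices rather than degrees; this leaves room
    for two basis vectors of degree 1. *)
Lemma graded_lie_exists s0 : S s0 -> exists L : finLieAlgType F,
  [/\ ~ nilpotent_lie L,
      exists Lg : G -> {vspace L},
        lie_grading Lg /\ grading_support Lg = range deg,
      metabelian_lie L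
    & \dim {:L} = #|T|].
Proof.
move=> Ss0; exists shift_lie; split.
- exact: shift_lie_not_nilpotent Ss0.
- exists degree_space; split; first exact: degree_space_grading.
  exact: degree_space_support.
- exact: shift_lie_metabelian.
- exact: shift_lie_dim.
Qed.

End GradedShift.

(** * Orbits inside a finite subset of a group *)

Section Orbits.
Context {G : groupType}.
Implicit Types (x g : G) (Y : set G).

Lemma finite_orbit_order Y x g : finite_set Y -> orbit_set x g `<=` Y ->
  exists n, (g ^+ n.+1 = 1)%g.
Proof.
move=> finY xgY; apply: contrapT => /forallNP gn1.
(* Without a trivial positive power of [g], the map from [n] to [x * g ^+ n] would embed the
   naturals in [Y]. *)
have neq m n : (x * g ^+ m = x * g ^+ (m + n.+1))%g -> False.
  by rewrite expgnDr => /mulgI; rewrite -[LHS]mulg1 => /mulgI /esym; exact: gn1.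
apply: infinite_nat.
rewrite (_ : setT = (fun n => (x * g ^+ n)%g) @^-1` Y); last first.
  by apply/seteqP; split => // n _; apply: xgY; exists n.
apply: finite_preimage finY => m n _ _ /= mn.
case: (ltngtP m n) => // /subnKC; rewrite addSnnS => mnE.
  by case: (neq m (n - m.+1)%N); rewrite mnE.
by case: (neq n (m - n.+1)%N); rewrite mnE.
Qed.

(** As [g] has finite order, its inverse is one of its nonnegative powers. *)
Lemma orbit_mulV Y x g y : finite_set Y -> orbit_set x g `<=` Y ->
  orbit_set x g y -> orbit_set x g (y * g^-1)%g.
Proof.
move=> finY xgY [n _ <-]; have [m gm1] := finite_orbit_order finY xgY.
exists (n + m)%N => //; apply: (mulIg g).
by rewrite mulgVK -mulgA -expgSr -addnS expgnDr gm1 mulg1.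
Qed.

Lemma not_arith_freeP Y : finite_set Y -> ~ arith_free Y ->
  exists x g, [/\ Y x, Y g, commute x g & orbit_set x g `<=` Y].
Proof.
move=> finY; apply: contra_notP => noxg; split=> // Z ZY comZ; split.
  exact: sub_finite_set finY.
move=> x g Zx Zg xgZ; apply: noxg; exists x, g; split; try exact: ZY.
  exact: comZ.
exact: subset_trans ZY.
Qed.

Lemma orbit_lie_exists (F : fieldType) Y x g :
    finite_set Y -> Y g -> commute x g -> orbit_set x g `<=` Y ->
    ~ orbit_set x g g ->
  exists L : finLieAlgType F,
    [/\ ~ nilpotent_lie L,
        exists Lg : G -> {vspace L},
          lie_grading Lg /\ grading_support Lg = Y,
        metabelian_lie L
      & \dim {:L} = #|` fset_set Y|%fset].
Proof.
move=> finY Yg xg xgY gNxg.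
have YP y : Y y -> y \in fset_set Y by move=> Yy; rewrite in_fset_set// inE.
have xgx : orbit_set x g x by exists 0%N; rewrite // expg0 mulg1.
pose T : finType := fset_set Y; pose deg (s : T) : G := val s.
pose S (s : T) := `[< orbit_set x g (deg s) >].
(* The default [s] is never taken on the orbit, which is closed under division by [g] and lies in
   [Y]. *)
pose tau (s : T) : T := insubd s (deg s * g^-1)%g.
have tauE s : S s -> deg (tau s) = (deg s * g^-1)%g.
  move=> /asboolP Ss; rewrite /deg insubdK //; apply/YP/xgY.
  exact: (orbit_mulV finY xgY Ss).
have degY : range deg = Y.
  apply/seteqP; split => [_ [s _ <-]|y Yy].
    by have := valP s; rewrite in_fset_set// inE.
  by exists [` YP y Yy]%fset.
rewrite cardfE -{1}degY.
apply: (@graded_lie_exists F G T deg [` YP _ Yg]%fset S tau _ _ _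
  [` YP _ (xgY _ xgx)]%fset).
- by apply/negP => /asboolP.
- move=> s Ss; apply/asboolP; rewrite tauE //.
  move/asboolP: Ss => Ss; exact: (orbit_mulV finY xgY Ss).
- move=> s Ss; rewrite tauE //=.
  have com : commute g (deg s).
    have /asboolP[n _ <-] := Ss; apply: commuteM; first exact: commute_sym.
    exact/commuteX/commute_refl.
  have comV : commute g (deg s * g^-1)%g.
    by apply: commuteM => //; exact/commuteV/commute_refl.
  by split => //; rewrite comV mulgVK.
- exact/asboolP.
Qed.

End Orbits.

(* The side condition on the dimension excludes only Y = {1}, which is not
   arithmetically free, whereas a 1-dimensional Lie algebra is abelian. *)
Theorem proposition3p8 (F : fieldType) (G : groupType) (Y : set G)
    (finY : finite_set Y) (nafY : ~ arith_free Y) :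
  exists L : finLieAlgType F,
    [/\ ~ nilpotent_lie L,
        exists Lg : G -> {vspace L},
          lie_grading Lg /\ grading_support Lg = Y,
        metabelian_lie L
      & Y <> [set 1%g] -> \dim {:L} = #|` fset_set Y|%fset ].
Proof.
have [x [g [Yx Yg xg xgY]]] := not_arith_freeP finY nafY.
have [gxg|gNxg] := pselect (orbit_set x g g); last first.
  have [L [? ? ? ?]] := orbit_lie_exists F finY Yg xg xgY gNxg.
  by exists L.
have Y1 : Y 1%g.
  by apply: (xgY); rewrite -(mulgV g); exact: (orbit_mulV finY xgY gxg).
(* The cyclic orbit of x contains g, hence is <g>; so 1 lies in Y and acts as
   the identity on any other element of Y. *)
have [[y [Yy y1]]|noy] := pselect (exists y, Y y /\ y <> 1%g).
  have y1E : orbit_set y 1%g = [set y].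
    apply/seteqP; split => [_ [n _ <-]|_ ->]; first by rewrite /= expg1n mulg1.
    by exists 0%N; rewrite // mulg1.
  have [|||L [? ? ? ?]] := @orbit_lie_exists G F Y y 1%g finY Y1.
  - exact: commute1.
  - by rewrite y1E => _ ->.
  - by rewrite y1E => /= /esym.
  by exists L.
have YE : Y = [set 1%g].
  apply/seteqP; split => [y Yy|_ ->] //=.
  by apply: contrapT => y1; apply: noy; exists y.
(* For Y = {1}, the 2-dimensional non-abelian Lie algebra, in degree 1. *)
have [||||L [? [Lg [? supp]] ? _]] :=
  @graded_lie_exists F G bool (fun=> 1%g) false id id _ _ _ true.
- by [].
- by [].
- by move=> s _; split; [rewrite mulg1|exact: commute_refl].
- by [].
exists L; split => //; exists Lg; split => //.
rewrite supp YE; apply/seteqP; split => [_ [_ _ <-]|_ ->] //.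
by exists true.
Qed.
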